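(* Let $\mathcal{H}$ be a real Hilbert space and let $\mathcal{C}\subset\mathcal{H}$ be a closed and pointed cone. Assume that (i) every face $\mathcal{F}$ of $\mathcal{C}$ is closed and has nonempty interior with respect to $\overline{\mathrm{span}}\,\mathcal{F}$; (ii) for every face $\mathcal{F}$ of $\mathcal{C}$, the dual cone $\mathcal{F}^\vee$ of $\mathcal{F}$ in the space $\overline{\mathrm{span}}\,\mathcal{F}$ is contained in $P_{\overline{\mathrm{span}}\,\mathcal{F}}(\mathcal{C}^\vee)$. Let $f:\mathcal{C}\to(-\infty,\infty]$ be proper. Then $f=f^{**}$ if and only if $f\in\Gamma_\nearrow(\mathcal{C})$.
   Context: $\mathcal{H}$ has inner product $\langle\cdot,\cdot\rangle$ and norm $|\cdot|$. A cone is a subset $\mathcal{C}\subset\mathcal{H}$ that is convex and contains the origin, i.e. $\alpha x+\beta y\in\mathcal{C}$ for all $x,y\in\mathcal{C}$ and $\alpha,\beta\ge 0$. It is pointed if $\mathcal{C}\cap(-\mathcal{C})=\{0\}$. Write $x\preceq y$ (equivalently $y\succeq x$) if $y-x\in\mathcal{C}$. $\overline{\mathrm{span}}$ denotes the closed linear span. The dual cone of a cone $\mathcal{K}$ is taken within its closed linear span: $\mathcal{K}^\vee=\{x\in\overline{\mathrm{span}}\,\mathcal{K}:\langle x,y\rangle\ge 0\ \forall y\in\mathcal{K}\}$; this applies to $\mathcal{C}$ and to its faces. A face of $\mathcal{C}$ is a subset $\mathcal{F}\subset\mathcal{C}$ which is a cone and satisfies: if $0\preceq x\preceq y$ and $y\in\mathcal{F}$,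 then $x\in\mathcal{F}$. For a closed subspace $\mathcal{H}'\subset\mathcal{H}$, $P_{\mathcal{H}'}$ is the orthogonal projection onto $\mathcal{H}'$. For $f:\mathcal{C}\to(-\infty,\infty]$: the monotone conjugate is $f^*(y)=\sup_{z\in\mathcal{C}}\{\langle z,y\rangle-f(z)\}$ for $y\in\mathcal{C}^\vee$, and the monotone biconjugate is $f^{**}(x)=\sup_{y\in\mathcal{C}^\vee}\{\langle y,x\rangle-f^*(y)\}$ for $x\in\mathcal{C}$. $f$ is proper if it is not identically $\infty$. $f$ is $\mathcal{C}$-nondecreasing if $f(x)\ge f(y)$ whenever $x\succeq y\succeq 0$. $\Gamma_\nearrow(\mathcal{C})$ is the set of functions $\mathcal{C}\to(-\infty,\infty]$ that are proper, convex, lower semicontinuous and $\mathcal{C}$-nondecreasing. *)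

(* Defs.v *)
From HB Require Import structures.
From mathcomp Require Import all_boot all_order all_algebra.
From mathcomp Require Import all_classical all_reals.
From mathcomp Require Import ereal topology normedtype.
Set Implicit Arguments.
Unset Strict Implicit.
Unset Printing Implicit Defensive.
Import Order.TTheory GRing.Theory Num.Theory.
Import numFieldNormedType.Exports.
Local Open Scope classical_set_scope.
Local Open Scope ring_scope.

Section Cones.
Variables (R : realType) (H : completeNormedModType R).
Implicit Types (A C F K V : set H) (x y z p : H).

Definition is_cone C :=
  C 0 /\ forall x y (a b : R), C x -> C y -> 0 <= a -> 0 <= b ->
    C (a *: x + b *: y).

Definition pointed_cone C := C `&` [set - x | x in C] = [set 0].

Definition cone_le C x y := C (y - x).

Definition is_face C F :=
  [/\ F `<=` C, is_cone F &
      forall x y, cone_le C 0 x -> cone_le C x y -> F y -> F x].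

Definition linear_span A : set H :=
  smallest [set V : set H | submod_closed (mem V)] A.

Definition closed_span A : set H := closure (linear_span A).

(* The interior is computed in the subspace topology of [closed_span F].  The
   points outside [closed_span F] are isolated in that topology, but none of
   them belongs to [F]. *)
Definition rel_interior F : set H :=
  interior (F : set (subspace (closed_span F))).

End Cones.

Section InnerProduct.
Variables (R : realType) (H : completeNormedModType R).
Variable (dot : {dot H for (@idfun R)}).
Implicit Types (A C F K V : set H) (x y z p : H).

(* Together with the completeness of [H], this makes [H] a real Hilbert space
   with inner product [dot]. *)
Definition norm_from_dot := forall x, `|x| = Num.sqrt (dot x x).

Definition dual_cone K : set H :=
  [set x | closed_span K x /\ forall y, K y -> 0 <= dot x y].

(* If [V] is a closed subspace of a Hilbert space, there is exactly one such
   point; the default value 0 is then never used. *)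
Definition orth_proj V x : H :=
  xget 0 [set p | V p /\ forall v, V v -> dot (x - p) v = 0].

Local Open Scope ereal_scope.

Definition conjugate_on (D : set H) (f : H -> \bar R) y : \bar R :=
  ereal_sup [set (dot z y)%:E - f z | z in D].

Definition mono_conjugate C f := conjugate_on C f.

Definition mono_biconjugate C f :=
  conjugate_on (dual_cone C) (mono_conjugate C f).

End InnerProduct.

(* A function C -> (-oo, +oo] is represented by a function on [H] of which only
   the values on [C] are used. *)
Section ConeFunctions.
Variables (R : realType) (H : completeNormedModType R) (C : set H).
Implicit Types (f g : H -> \bar R) (x y : H).
Local Open Scope ereal_scope.

Definition gt_ninfty_on f := forall x, C x -> -oo < f x.

Definition proper_on f := ~ (forall x, C x -> f x = +oo).

Definition convex_on f := forall x y (t : R), C x -> C y ->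
  (0 <= t <= 1)%R ->
  f (t *: x + (1 - t) *: y)%R <= t%:E * f x + (1 - t)%:E * f y.

(* As in [rel_interior], the points outside [C] are isolated in [subspace C],
   so this only constrains [f] on [C], with its induced topology. *)
Definition lsc_on f := lower_semicontinuous (f : subspace C -> \bar R).

Definition cone_nondecreasing f := forall x y,
  cone_le C y x -> cone_le C 0%R y -> f y <= f x.

Definition Gamma_mono f :=
  [/\ gt_ninfty_on f, proper_on f, convex_on f, lsc_on f &
      cone_nondecreasing f].

End ConeFunctions.

(* Main.v *)
Require Import Defs.
From HB Require Import structures.
From mathcomp Require Import all_boot all_order all_algebra.
From mathcomp Require Import all_classical all_reals.
From mathcomp Require Import ereal topology normedtype.
From mathcomp Require Import ring lra.
Set Implicit Arguments.
Unset Strict Implicit.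
Unset Printing Implicit Defensive.
Import Order.TTheory GRing.Theory Num.Theory.
Import numFieldNormedType.Exports.
Local Open Scope classical_set_scope.
Local Open Scope ring_scope.

(** If [f] equals its monotone biconjugate, it is a supremum on [C] of
continuous affine functions whose slopes lie in the dual cone of [C]; such a
supremum is convex, lower semicontinuous and nondecreasing.

For the converse, let [x] be in [C] and [r < f x]; an affine minorant of [f]
with slope in the dual cone and with value at least [r] at [x] is needed.  Such
minorants are also minorants of the largest nondecreasing extension of [f] to
[H], so one separates [(x, r)] from the downward epigraph
[{(z - v, b) | f z <= b, v >= 0}].  The obstruction is that [x] may lie on the
boundary of [C]: points near [x] may be outside [C], where monotonicity of [f]
says nothing about them.

Faces remove this obstruction.  Since the face generated by the domain of [f]
has a relative interior point, some [e] in the domain dominates every point of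
the domain up to a scalar ([domain_dominating_point]).  Let [G] be the face
generated by [e + x].  It contains [x] and the domain of [f], and each point
[t e + (1 - t) x] with [0 < t < 1] is in its relative interior
([segment_rel_interior]).  If [(x, r)] were a limit of points [(z - v, b)] of
the downward epigraph with [v] in [G], then the points
[t e + (1 - t) (z - v)] would eventually be in [G], hence comparable with
[t e + (1 - t) z] in [C]; monotonicity, convexity and semicontinuity at
[t e + (1 - t) x] would give [f (t e + (1 - t) x) <= t f e + (1 - t) r], and
[t -> 0] would give [f x <= r] ([not_closure_downward_epigraph]).

So the projection theorem in the Hilbert space [H * R]
([variational_projection]) yields a hyperplane with normal [(y, s)] separating
[(x, r)] from the downward epigraph with [v] restricted to [G].  As this set is
stable under subtraction of elements of [G], [y] is in the dual cone of [G], and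
hypothesis [hii] replaces it by an element of the dual cone of [C] with the same
values on [G], thus on the domain of [f].  If [s < 0], dividing by [- s] gives
the minorant.  If [s = 0], large multiples of [y] are added to a minorant
obtained by separating below the graph at [e], where the hyperplane cannot be
vertical ([affine_minorant_above]). *)

(** * The Hilbert space [H * R] *)

(* Completeness is stated over a pointed uniform structure, so products need
   one. *)
HB.instance Definition _ (U V : puniformType) := Pointed.on (U * V)%type.

Section ProductComplete.
Variables U V : completeType.

(** Both coordinates of a Cauchy filter are Cauchy, and the filter converges to
the pair of their limits. *)
Lemma prod_complete (F : set_system (U * V)%type) :
  ProperFilter F -> cauchy F -> [cvg F in (U * V)%type].
Proof.
move=> FF Fc.
have c1 : cauchy (fst @ F : set_system U).
  move=> A entA.
  have := Fc _ (prod_entP entA (@filterT _ (@entourage V) _)).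
  case=> -[P Q] /= [FP FQ] PQ.
  exists ((@fst U V) @` P, (@fst U V) @` Q); first split=> /=.
  - by apply: filterS FP => z Pz; exists z.
  - by apply: filterS FQ => z Pz; exists z.
  move=> [u1 u2] /= [[p Pp <-] [q Qq <-]].
  by have [Aa _] := PQ (p, q) (conj Pp Qq).
have c2 : cauchy (snd @ F : set_system V).
  move=> A entA.
  have := Fc _ (prod_entP (@filterT _ (@entourage U) _) entA).
  case=> -[P Q] /= [FP FQ] PQ.
  exists ((@snd U V) @` P, (@snd U V) @` Q); first split=> /=.
  - by apply: filterS FP => z Pz; exists z.
  - by apply: filterS FQ => z Pz; exists z.
  move=> [u1 u2] /= [[p Pp <-] [q Qq <-]].
  by have [_ Aa] := PQ (p, q) (conj Pp Qq).
have Fu : [cvg (fst @ F) in U] by exact: cauchy_cvg.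
have Fv : [cvg (snd @ F) in V] by exact: cauchy_cvg.
apply: (@cvgP _ _ (lim (fst @ F), lim (snd @ F))).
move=> A /(cvg_pair Fu Fv); rewrite /preimage /=.
by apply: (@filterS _ F) => -[].
Qed.

HB.instance Definition _ := Uniform_isComplete.Build (U * V)%type prod_complete.
End ProductComplete.
HB.instance Definition _ (R : realType) (U V : completeNormedModType R) :=
  Complete.on (U * V)%type.

Section Dot.
Variables (R : realType) (H : lmodType R) (dot : {dot H for (@idfun R)}).
Implicit Types x y z : H.

Lemma dotC x y : dot x y = dot y x.
Proof. by rewrite hermitian_subproof expr0 mul1r. Qed.
Lemma dotDl x y z : dot (x + y) z = dot x z + dot y z.
Proof. exact: linearDl. Qed.
Lemma dotBl x y z : dot (x - y) z = dot x z - dot y z.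
Proof. exact: linearBl. Qed.
Lemma dotZl a x y : dot (a *: x) y = a * dot x y.
Proof. exact: linearZl_LR. Qed.
Lemma dotDr x y z : dot x (y + z) = dot x y + dot x z.
Proof. exact: linearDr. Qed.
Lemma dotBr x y z : dot x (y - z) = dot x y - dot x z.
Proof. exact: linearBr. Qed.
Lemma dotZr a x y : dot x (a *: y) = a * dot x y.
Proof. exact: linearZr_LR. Qed.
Lemma dot0r x : dot x 0 = 0. Proof. exact: linear0r. Qed.

Lemma dotxx_ge0 x : 0 <= dot x x.
Proof.
have [->|x0] := eqVneq x 0; first by rewrite dot0r.
exact/ltW/neq0_dnorm_gt0.
Qed.

End Dot.

Section ProductDot.
Variables (R : realType) (H : lmodType R) (dot : {dot H for (@idfun R)}).

Definition prod_dot (p q : H * R) : R := dot p.1 q.1 + p.2 * q.2.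

Let prod_dot_bilinear : bilinear_for
  (GRing.Scale.Law.clone _ _ *%R _)
  (GRing.Scale.Law.clone _ _ (@idfun R \; *%R) _)
  prod_dot.
Proof.
split=> [q|p] a u v; rewrite /prod_dot /=.
- by rewrite dotDl dotZl /GRing.scale/=; ring.
- by rewrite dotDr dotZr /GRing.scale/=; ring.
Qed.

HB.instance Definition _ :=
  bilinear_isBilinear.Build R _ _ _ _ _ prod_dot prod_dot_bilinear.
Let prod_dot_hermitian x y :
  prod_dot x y = (-1) ^+ false * idfun (prod_dot y x).
Proof. by rewrite expr0 mul1r /prod_dot dotC mulrC. Qed.

HB.instance Definition _ :=
  @isHermitianSesquilinear.Build R _ false idfun prod_dot prod_dot_hermitian.
Let prod_dot_gt0 p : p != 0 -> 0 < prod_dot p p.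
Proof.
case: p => u r; rewrite xpair_eqE negb_and /prod_dot /= => /orP[u0|r0].
  by rewrite ltr_wpDr ?neq0_dnorm_gt0 // -expr2 sqr_ge0.
by rewrite ltr_wpDl ?dotxx_ge0 // -expr2 exprn_even_gt0.
Qed.

HB.instance Definition _ := isDotProduct.Build R _ prod_dot prod_dot_gt0.
End ProductDot.

(** * Projection onto a convex set *)

(** The norm of [T] is only assumed to be equivalent to the norm of [dot]: on
[H * R] the former is the maximum of the norms of the coordinates. *)
Section Projection.
Variables (R : realType) (T : completeNormedModType R).
Variables (dot : {dot T for (@idfun R)}) (K : R).
Hypothesis K_ge0 : 0 <= K.
Hypothesis norm_le_dot : forall x, `|x| ^+ 2 <= dot x x.
Hypothesis dot_le_norm : forall x, dot x x <= K * `|x| ^+ 2.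
Implicit Types x y z : T.

Lemma subr_convex_comb (t : R) x y z :
  x - (t *: y + (1 - t) *: z) = t *: (x - y) + (1 - t) *: (x - z).
Proof.
by rewrite !scalerBr addrACA -scalerDl [t + _]addrC subrK scale1r -opprD.
Qed.

Lemma dot_cauchy_schwarz x y : dot x y ^+ 2 <= dot x x * dot y y.
Proof.
have [->|y0] := eqVneq y 0; first by rewrite !dot0r expr0n mulr0.
have yy : 0 < dot y y by exact: neq0_dnorm_gt0.
have := dotxx_ge0 dot (dot y y *: x - dot x y *: y).
rewrite dotBl !dotBr !dotZl !dotZr (dotC dot y x) => h.
rewrite -subr_ge0 -(pmulr_rge0 _ yy).
by apply: le_trans h _; rewrite le_eqVlt; apply/orP; left; apply/eqP; ring.
Qed.

Lemma dot_le x y : `|dot x y| <= K * `|x| * `|y|.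
Proof.
rewrite -(@ler_pXn2r _ 2) ?nnegrE ?mulr_ge0 //.
rewrite -normrX ger0_norm ?sqr_ge0 //.
apply: le_trans (dot_cauchy_schwarz x y) _.
have -> : (K * `|x| * `|y|) ^+ 2 = (K * `|x| ^+ 2) * (K * `|y| ^+ 2) by ring.
by apply: ler_pM; rewrite ?dotxx_ge0.
Qed.

Lemma dot_continuous y : continuous (dot y).
Proof.
move=> x; apply/cvgrPdist_lt => e e0.
pose M := K * `|y| + 1.
have M0 : 0 < M by rewrite ltr_wpDl // mulr_ge0.
near=> z.
rewrite -dotBr; apply: le_lt_trans (dot_le _ _) _.
apply: (@le_lt_trans _ _ (M * `|x - z|)).
  by rewrite ler_wpM2r // /M ler_wpDr.
rewrite mulrC -ltr_pdivlMr //.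
near: z; apply: cvgr_dist_lt; last exact: divr_gt0.
exact: cvg_id.
Unshelve. all: by end_near. Qed.

Lemma dotxx_continuous : continuous (fun x => dot x x).
Proof.
move=> x; apply/cvgrPdist_lt => e e0.
pose M := K * (`|x| + (`|x| + 1)) + 1.
have M0 : 0 < M by rewrite ltr_wpDl // mulr_ge0 // !addr_ge0.
near=> z.
have -> : dot x x - dot z z = dot (x + z) (x - z).
  by rewrite dotDl !dotBr (dotC _ z x); ring.
apply: le_lt_trans (dot_le _ _) _.
apply: (@le_lt_trans _ _ (M * `|x - z|)).
  rewrite ler_wpM2r // /M ler_wpDr // ler_wpM2l //.
  apply: le_trans (ler_normD _ _) _; rewrite lerD2l.
  rewrite -[z](subrKC x); apply: le_trans (ler_normD _ _) _.
  rewrite lerD2l distrC ltW //.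
rewrite mulrC -ltr_pdivlMr //.
near: z; apply: cvgr_dist_lt; last exact: divr_gt0.
exact: cvg_id.
Unshelve. all: by end_near. Qed.

(** A minimizing filter of the distance to [x] on [E] is Cauchy by the
parallelogram law, and its limit [p] is the nearest point to [x] in the closure
of [E].  The inequality says that the distance to [x] does not decrease when one
moves from [p] towards a point [q] of [E]. *)
Theorem variational_projection (E : set T) x :
  E !=set0 ->
  (forall a b (t : R), E a -> E b -> 0 <= t <= 1 ->
     E (t *: a + (1 - t) *: b)) ->
  exists2 p, closure E p & forall q, E q -> dot (x - p) (q - p) <= 0.
Proof.
move=> [e0 Ee0] Econv.
pose Q (a : T) := dot a a.
pose D := [set Q (x - a) | a in E].
have hD : has_inf D.
  split; first by exists (Q (x - e0)); exists e0.
  by exists 0 => _ [a Ea <-]; exact: dotxx_ge0.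
pose d := inf D.
have dQ a : E a -> d <= Q (x - a).
  by move=> Ea; apply: ge_inf; [case: hD|exists a].
pose B (del : R) := [set a | E a /\ Q (x - a) < d + del].
pose F := filter_from [set del : R | 0 < del] B.
have F_proper : ProperFilter F.
  apply: filter_from_proper.
    apply: filter_from_filter; first by exists 1; exact: ltr01.
    move=> i j /= i0 j0; exists (Num.min i j); first by rewrite /= lt_min i0.
    move=> a [Ea]; rewrite -ltrBlDl lt_min => /andP[].
    by rewrite !ltrBlDl => ? ?; split; split.
  move=> del /= del0; have [_ [a Ea <-] ha] := inf_adherent del0 hD.
  by exists a; split.
have Fc : cauchy F.
  apply/cauchy_exP => e e_gt0.
  have del0 : 0 < (e / 2) ^+ 2 by rewrite exprn_gt0 // divr_gt0.
  have [_ [a Ea <-] ha] := inf_adherent del0 hD.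
  exists a; exists ((e / 2) ^+ 2) => // b [Eb hb].
  rewrite -ball_normE /= -(@ltr_pXn2r _ 2) ?nnegrE ?(ltW e_gt0) //.
  apply: le_lt_trans (norm_le_dot _) _.
  have m : E (2^-1 *: a + (1 - 2^-1) *: b) by apply: Econv => //; lra.
  have -> : a - b = (x - b) - (x - a) by rewrite opprB [RHS]addrC addrA subrK.
  move: (dQ _ m) ha hb; rewrite /Q subr_convex_comb.
  move: (x - a) (x - b) => u v.
  rewrite dotBl !dotBr dotDl !dotDr !dotZl !dotZr (dotC _ v u) expr_div_n.
  rewrite -/d; lra.
have Fp : [cvg F in T] by exact: cauchy_cvg.
set p := lim F in Fp; exists p.
  move=> A /Fp [del del0 BA].
  have [_ [a Ea <-] ha] := inf_adherent del0 hD.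
  by exists a; split => //; apply: BA; split.
move=> q Eq.
(* [t *: q + (1 - t) *: p] is a limit of points of [E], so it is not nearer to
   [x] than the infimum of the distances. *)
have approx t : 0 <= t <= 1 ->
    Q (x - p) <= Q (x - (t *: q + (1 - t) *: p)).
  move=> t01.
  pose g a := Q (x - (t *: q + (1 - t) *: a)) - Q (x - a).
  have gp : g a @[a --> F] --> g p.
    have tp : t *: q + (1 - t) *: a @[a --> F] --> t *: q + (1 - t) *: p.
      by apply: cvgD; [exact: cvg_cst|exact: cvgZr].
    have xp : x - a @[a --> F] --> x - p by apply: cvgB => //; exact: cvg_cst.
    have xtp : x - (t *: q + (1 - t) *: a) @[a --> F] -->
               x - (t *: q + (1 - t) *: p) by apply: cvgB => //; exact: cvg_cst.
    exact: cvgB (cvg_comp _ _ xtp (@dotxx_continuous _))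
                (cvg_comp _ _ xp (@dotxx_continuous _)).
  rewrite -subr_ge0 -/(g p) leNgt; apply/negP => gp0.
  have gl : g p < g p / 2 by lra.
  have [a [gal [Ea]]] : exists a, g a < g p / 2 /\ B (- (g p / 2)) a.
    apply: (@filter_ex _ F); apply: filterI; first exact: cvgr_lt gp _ gl.
    by exists (- (g p / 2)) => //=; lra.
  have := dQ _ (Econv _ _ _ Eq Ea t01).
  rewrite /g in gal *; lra.
rewrite leNgt; apply/negP => c_gt0.
set c := dot _ _ in c_gt0; pose h := Q (q - p).
have h_ge0 : 0 <= h := dotxx_ge0 _ _.
(* From [p] to the point of parameter [t] on the segment, the squared distance
   to [x] changes by [t ^+ 2 * h - 2 * t * c], which is negative for this
   [t]. *)
pose t := c / (c + h).
have ch : 0 < c + h by lra.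
have t0 : 0 < t by rewrite divr_gt0.
have t01 : 0 <= t <= 1 by rewrite (ltW t0) ler_pdivrMr // mul1r lerDl.
have tc : t * (c + h) = c by rewrite /t divfK // gt_eqF.
have := approx t t01; rewrite subr_convex_comb.
have -> : t *: (x - q) + (1 - t) *: (x - p) = (x - p) - t *: (q - p).
  rewrite scalerBl scale1r addrCA -scalerBr; congr (_ + _).
  by rewrite -scalerN !opprB addrC subrKA.
have expand u v : Q (u - t *: v) = Q u - 2 * t * dot u v + t ^+ 2 * Q v.
  by rewrite /Q dotBl !dotBr !dotZl !dotZr (dotC _ v u); ring.
rewrite expand -/c -/h.
nra.
Qed.

End Projection.

(** * Closed linear spans and relative interiors *)

Section Span.
Variables (R : realType) (H : completeNormedModType R).
Implicit Types (A : set H) (x y : H) (a : R).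

Lemma linear_span_lin A a x y :
  linear_span A x -> linear_span A y -> linear_span A (a *: x + y).
Proof.
move=> Ax Ay V [/= [V0 Vlin] AV].
by have := Vlin a x y; rewrite !inE; apply; [exact: Ax|exact: Ay].
Qed.

Lemma sub_closed_span A : A `<=` closed_span A.
Proof. by move=> x Ax; apply: subset_closure; exact: sub_gen_smallest. Qed.

Lemma closed_span0 A : closed_span A 0.
Proof. by apply: subset_closure => V [/= [V0 _] _]; rewrite inE in V0. Qed.

Lemma closed_span_lin A a x y :
  closed_span A x -> closed_span A y -> closed_span A (a *: x + y).
Proof.
move=> Ax Ay B Bxy.
have cxy : a *: z.1 + z.2 @[z --> (x, y)] --> a *: x + y.
  by apply: cvgD; [apply: cvgZr; exact: cvg_fst|exact: cvg_snd].
have [[U V] /= [Ux Vy] UV] := cxy _ Bxy.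
have [u [Au Uu]] := Ax _ Ux; have [v [Av Vv]] := Ay _ Vy.
exists (a *: u + v); split; first exact: linear_span_lin.
exact: (UV (u, v)).
Qed.

Lemma closed_spanZ A a x : closed_span A x -> closed_span A (a *: x).
Proof.
by move=> Ax; rewrite -[a *: x]addr0; apply: closed_span_lin (closed_span0 A).
Qed.

Lemma closed_spanD A x y :
  closed_span A x -> closed_span A y -> closed_span A (x + y).
Proof. by rewrite -{2}[x]scale1r; exact: closed_span_lin. Qed.

Lemma closed_spanB A x y :
  closed_span A x -> closed_span A y -> closed_span A (x - y).
Proof.
by move=> Ax Ay; rewrite addrC -scaleN1r; exact: closed_span_lin.
Qed.

Lemma rel_interior_ball A z : rel_interior A z ->
  exists2 eps : R, 0 < eps &
    forall v, closed_span A v -> `|z - v| < eps -> A v.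
Proof.
rewrite /rel_interior /interior /= => zA.
have Az : A z := nbhs_subspace_singleton zA.
move: zA; rewrite /nbhs /= -nbhs_subspace_in; last exact: sub_closed_span.
move=> /nbhs_ballP[e /= e0 eA]; exists e => // v Av zv.
by apply: eA => //; rewrite -ball_normE.
Qed.

End Span.

(** * Faces *)

Section Face.
Variables (R : realType) (H : completeNormedModType R) (C : set H).
Hypothesis C_cone : is_cone C.
Implicit Types (D F : set H) (x y z g e : H) (a b l : R).

Lemma coneD x y : C x -> C y -> C (x + y).
Proof. by move=> Cx Cy; rewrite -[x]scale1r -[y]scale1r; apply: C_cone.2. Qed.

Lemma coneZ a x : 0 <= a -> C x -> C (a *: x).
Proof.
by move=> a0 Cx; rewrite -[_ *: _]addr0 -(scale0r x); apply: C_cone.2.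
Qed.

(** For a nonempty convex subset [D] of [C], this is the least face of [C]
containing [D]. *)
Definition face_gen D : set H :=
  [set z | C z /\ exists w l, [/\ D w, 0 <= l & C (l *: w - z)]].

Lemma face_genP D : D !=set0 -> D `<=` C ->
  (forall x y (t : R), D x -> D y -> 0 <= t <= 1 ->
     D (t *: x + (1 - t) *: y)) ->
  is_face C (face_gen D).
Proof.
move=> [d Dd] DC Dconv; split=> [z []//||x y].
- split=> [|x y a b [Cx [w [l [Dw l0 lw]]]] [Cy [v [m [Dv m0 mv]]]] a0 b0].
    split; first exact: C_cone.1.
    by exists d, 0; rewrite scale0r subr0; split => //; exact: C_cone.1.
  split; first exact: C_cone.2.
  have al0 : 0 <= a * l by exact: mulr_ge0.
  have bm0 : 0 <= b * m by exact: mulr_ge0.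
  (* [a *: x + b *: y] is dominated by [(a * l) *: w + (b * m) *: v], which is
     [s := a * l + b * m] times a convex combination of [w] and [v]. *)
  have Cs : C (((a * l) *: w + (b * m) *: v) - (a *: x + b *: y)).
    rewrite opprD addrACA -!scalerA -!scalerBr.
    by apply: coneD; exact: coneZ.
  have [s0|s_neq0] := eqVneq (a * l + b * m) 0.
    have [al_eq0 bm_eq0] : a * l = 0 /\ b * m = 0 by lra.
    move: Cs; rewrite al_eq0 bm_eq0 !scale0r addr0 => Cs.
    by exists d, 0; rewrite scale0r.
  set s := a * l + b * m in s_neq0.
  have s0 : 0 < s by rewrite lt_neqAle eq_sym s_neq0 addr_ge0.
  exists ((a * l / s) *: w + (1 - a * l / s) *: v), s; split.
  + apply: Dconv => //; rewrite divr_ge0 ?(ltW s0) //=.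
    by rewrite ler_pdivrMr // mul1r lerDl.
  + exact: ltW.
  + have sal : s * (a * l / s) = a * l by rewrite mulrC divfK.
    have sbm : s - a * l = b * m by rewrite /s addrAC subrr add0r.
    by rewrite scalerDr !scalerA mulrBr mulr1 sal sbm.
- rewrite /cone_le subr0 => Cx Cyx [Cy [w [l [Dw l0 lw]]]]; split => //.
  exists w, l; split => //; rewrite -(subrKA y); exact: coneD.
Qed.

Lemma face_gen1P g : C g -> is_face C (face_gen [set g]).
Proof.
move=> Cg; apply: face_genP; first by exists g.
  by move=> _ ->.
by move=> _ _ t -> -> _ /=; rewrite -scalerDl addrC subrK scale1r.
Qed.

Lemma sub_face_gen D : D `<=` C -> D `<=` face_gen D.
Proof.
move=> DC z Dz; split; first exact: DC.
exists z, 1; split => //; rewrite scale1r subrr; exact: C_cone.1.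
Qed.

Lemma rel_interior_absorbing F z x : rel_interior F z -> F x ->
  exists2 l, 0 < l & F (z - l *: x).
Proof.
move=> zF Fx; have Fz : F z := nbhs_subspace_singleton zF.
have [eps eps0 ballF] := rel_interior_ball zF.
have x1 : 0 < `|x| + 1 by rewrite ltr_wpDl.
exists (eps / (`|x| + 1)); first exact: divr_gt0.
apply: ballF.
  by apply: closed_spanB; [|apply: closed_spanZ]; exact: sub_closed_span.
rewrite subKr normrZ gtr0_norm ?divr_gt0 // mulrAC ltr_pdivrMr //.
by rewrite ltr_pM2l // ltrDl.
Qed.

(** [l *: g] is the sum of the relative interior point [z] and of the element
[l *: g - z] of the face, so it is a relative interior point, and so is [g]. *)
Lemma rel_interior_face_dominating F z g l : is_face C F ->
  rel_interior F z -> F g -> 0 < l -> C (l *: g - z) ->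
  exists2 eps : R, 0 < eps &
    forall v, closed_span F v -> `|g - v| < eps -> F v.
Proof.
move=> [FC [F0 Fcone] Fdown] zF Fg l0 Clg.
have Fz : F z := nbhs_subspace_singleton zF.
have [eps eps0 ballF] := rel_interior_ball zF.
have FZ a y : 0 <= a -> F y -> F (a *: y).
  by move=> a0 Fy; rewrite -[_ *: _]addr0 -(scale0r y); apply: Fcone.
have Flg : F (l *: g - z).
  apply: (Fdown _ (l *: g)).
  + by rewrite /cone_le subr0.
  + by rewrite /cone_le opprB addrC subrK; exact: FC.
  + by apply: FZ => //; exact: ltW.
exists (eps / l); first exact: divr_gt0.
move=> v Fv gv; rewrite -[v](scalerK (lt0r_neq0 l0)).
apply: FZ; first by rewrite invr_ge0 ltW.
have Fu : F (z + l *: (v - g)).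
  apply: ballF.
    apply: closed_spanD; first exact: sub_closed_span.
    by apply: closed_spanZ; apply: closed_spanB => //; exact: sub_closed_span.
  rewrite opprD addNKr normrN normrZ gtr0_norm // distrC.
  by rewrite mulrC -ltr_pdivlMr.
have -> : l *: v = 1 *: (z + l *: (v - g)) + 1 *: (l *: g - z).
  by rewrite !scale1r addrC subrKA -scalerDr addrC subrK.
by apply: Fcone.
Qed.

(** A relative interior point [z0] of the generated face lies below a multiple
of some [e] in [D]; as [z0] can absorb a positive multiple of any [z] in [D],
the point [e] dominates all of [D] up to scalars. *)
Lemma dominating_point D : D !=set0 -> D `<=` C ->
  rel_interior (face_gen D) !=set0 ->
  exists2 e, D e & forall z, D z -> exists2 l : R, 0 <= l & C (l *: e - z).
Proof.
move=> D0 DC [z0 z0F].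
have [Cz0 [e [l [De l0 lz]]]] := nbhs_subspace_singleton z0F.
exists e => // z Dz.
have [m m0 [Cm _]] := rel_interior_absorbing z0F (sub_face_gen DC Dz).
exists (m^-1 * l); first by rewrite mulr_ge0 // invr_ge0 ltW.
rewrite -scalerA -[z in _ - z](scalerK (lt0r_neq0 m0)) -scalerBr.
apply: coneZ => //; first by rewrite invr_ge0 ltW.
by rewrite -(subrKA z0); exact: coneD.
Qed.

(** Every interior point of the segment from [x] to [e] dominates a positive
multiple of [e + x], hence a multiple of any point of the face that [e + x]
generates. *)
Lemma segment_rel_interior e x (t : R) : C e -> C x ->
  rel_interior (face_gen [set e + x]) !=set0 -> 0 < t < 1 ->
  exists2 eps : R, 0 < eps &
    forall v, closed_span (face_gen [set e + x]) v ->
      `|t *: e + (1 - t) *: x - v| < eps -> face_gen [set e + x] v.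
Proof.
set G := face_gen _; move=> Ce Cx [z zG] /andP[t0 t1].
have Cex : C (e + x) by exact: coneD.
have Gface : is_face C G by exact: face_gen1P.
have [_ [_ [m [-> m0 mz]]]] := nbhs_subspace_singleton zG.
have t1' : 0 < 1 - t by rewrite subr_gt0.
set g := t *: e + (1 - t) *: x.
have Cg : C g by apply: C_cone.2 => //; exact: ltW.
(* The multiple is [t * (1 - t)], because
   [g = t (1 - t) (e + x) + t ^ 2 e + (1 - t) ^ 2 x]. *)
have mu0 : 0 < t * (1 - t) by exact: mulr_gt0.
have Cgmu : C (g - (t * (1 - t)) *: (e + x)).
  have -> : g - (t * (1 - t)) *: (e + x) = t ^+ 2 *: e + (1 - t) ^+ 2 *: x.
    rewrite /g scalerDr opprD addrACA -!scalerBl.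
    by congr (_ *: _ + _ *: _); ring.
  by apply: C_cone.2 => //; exact: sqr_ge0.
apply: (rel_interior_face_dominating (l := m / (t * (1 - t)) + 1) Gface zG).
- split => //; exists (e + x), 1; split => //.
  have -> : 1 *: (e + x) - g = (1 - t) *: e + t *: x.
    by rewrite scale1r /g opprD addrACA !scalerBl !scale1r subKr.
  by apply: C_cone.2 => //; exact: ltW.
- by rewrite ltr_wpDl // divr_ge0 // ltW.
- have -> : (m / (t * (1 - t)) + 1) *: g - z =
      (m / (t * (1 - t))) *: (g - (t * (1 - t)) *: (e + x)) +
      (g + (m *: (e + x) - z)).
    rewrite scalerDl scale1r scalerBr scalerA divfK ?gt_eqF //.
    move: (g) (m *: _) => u v.
    by rewrite -!addrA [RHS]addrA -addrA; congr (_ + _); rewrite addrCA addKr.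
  apply: coneD => //; first by apply: coneZ => //; rewrite divr_ge0 // ltW.
  exact: coneD.
Qed.

End Face.

(** * Orthogonal projection and dual cones *)

Section Hilbert.
Variables (R : realType) (H : completeNormedModType R).
Variables (dot : {dot H for (@idfun R)}) (hdot : norm_from_dot dot).
Implicit Types (x y z : H) (A : set H).

Lemma dotxx_norm x : dot x x = `|x| ^+ 2.
Proof. by rewrite hdot sqr_sqrtr // dotxx_ge0. Qed.

Lemma closed_closed_span A : closed (closed_span A).
Proof. exact: closed_closure. Qed.

Lemma orth_projE A x v : closed_span A v ->
  dot (orth_proj dot (closed_span A) x) v = dot x v.
Proof.
move=> Av; pose V := closed_span A.
have [p Vp hp] : exists2 p, closure V p &
    forall q, V q -> dot (x - p) (q - p) <= 0.
  apply: (@variational_projection _ _ dot 1) => //.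
  - by move=> z; rewrite dotxx_norm.
  - by move=> z; rewrite dotxx_norm mul1r.
  - by exists 0; exact: closed_span0.
  - by move=> a b t Va Vb _; apply: closed_spanD; exact: closed_spanZ.
have {}Vp : V p by rewrite (closure_id V).1 //; exact: closed_closed_span.
have : exists q, V q /\ forall w, V w -> dot (x - q) w = 0.
  exists p; split => // w Vw; apply/eqP; rewrite eq_le; apply/andP; split.
    have := hp _ (closed_spanD Vp Vw).
    by rewrite addrAC subrr add0r.
  have := hp _ (closed_spanB Vp Vw).
  by rewrite addrAC subrr add0r -[- w]scaleN1r dotZr mulN1r oppr_le0.
move=> /(xgetPex 0) [_ /(_ _ Av)].
by rewrite -/(orth_proj _ _ _) dotBl => /eqP; rewrite subr_eq0 => /eqP.
Qed.

Lemma dual_coneZ A a y : 0 <= a ->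
  dual_cone dot A y -> dual_cone dot A (a *: y).
Proof.
move=> a0 [Ay yA]; split; first exact: closed_spanZ.
by move=> z Az; rewrite dotZl mulr_ge0 // yA.
Qed.

Lemma dual_coneD A x y :
  dual_cone dot A x -> dual_cone dot A y -> dual_cone dot A (x + y).
Proof.
move=> [Ax xA] [Ay yA]; split; first exact: closed_spanD.
by move=> z Az; rewrite dotDl addr_ge0 ?xA ?yA.
Qed.

Lemma prod_norm_le_dot (p : H * R) : `|p| ^+ 2 <= prod_dot dot p p.
Proof.
rewrite prod_normE /prod_dot dotxx_norm -expr2.
rewrite -[p.2 ^+ 2]real_normK ?num_real //.
by case: (leP `|p.1| `|p.2|) => _; rewrite ?lerDr ?lerDl sqr_ge0.
Qed.

Lemma prod_dot_le_norm (p : H * R) : prod_dot dot p p <= 2 * `|p| ^+ 2.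
Proof.
rewrite prod_normE /prod_dot dotxx_norm -expr2.
rewrite -[p.2 ^+ 2]real_normK ?num_real //.
rewrite mulr_natl mulr2n; apply: lerD; rewrite ler_sqr ?nnegrE //.
all: by rewrite le_max lexx ?orbT.
Qed.

End Hilbert.

(** * The downward epigraph *)

Lemma lty_EFin_ub (R : realType) (x : \bar R) : (x < +oo)%E ->
  exists a : R, (x <= a%:E)%E.
Proof.
by case: x => [a| |] // _; [exists a|exists 0]; rewrite ?lee_fin ?leNye.
Qed.

Lemma EFin_lt_dense (R : realType) (a : R) (x : \bar R) : (a%:E < x)%E ->
  exists2 b, a < b & (b%:E < x)%E.
Proof.
case: x => [y| |] //; last by exists (a + 1); rewrite ?ltry // ltrDl.
by rewrite lte_fin => ay; exists ((a + y) / 2); rewrite ?lte_fin; lra.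
Qed.

Section Functions.
Variables (R : realType) (H : completeNormedModType R) (C : set H).
Hypothesis C_cone : is_cone C.
Variable f : H -> \bar R.
Implicit Types (x y z : H) (a r t : R).

Lemma lsc_onP : lsc_on C f <->
  forall x a, C x -> (a%:E < f x)%E ->
    \forall z \near x, C z -> (a%:E < f z)%E.
Proof.
split=> [flsc x a Cx ax|flsc x a ax].
  have [V + Va] := flsc x a ax.
  rewrite /nbhs /= -nbhs_subspace_in // => VC.
  by apply: filterS VC => z; exact: Va.
have [Cx|nCx] := pselect (C x).
  exists [set z | C z /\ (a%:E < f z)%E]; last by move=> z [Cz ?].
  rewrite /nbhs /= -nbhs_subspace_in // /within /=.
  by apply: filterS (flsc x a Cx ax) => z za Cz; split => //; exact: za.
exists [set x]; last by move=> _ ->.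
by rewrite /nbhs /= -nbhs_subspace_out.
Qed.

Hypothesis f_convex : convex_on C f.
Hypothesis f_lsc : lsc_on C f.
Hypothesis f_mono : cone_nondecreasing C f.

Lemma epi_convex x y (a b t : R) : C x -> C y -> 0 <= t <= 1 ->
  (f x <= a%:E)%E -> (f y <= b%:E)%E ->
  (f (t *: x + (1 - t) *: y)%R <= (t * a + (1 - t) * b)%:E)%E.
Proof.
move=> Cx Cy t01 fa fb; apply: le_trans (f_convex Cx Cy t01) _.
have /andP[t0 t1] := t01.
by rewrite [leRHS]EFinD !EFinM leeD // lee_wpmul2l // lee_fin // subr_ge0.
Qed.

(** Subtracting [v] in [G] makes every slope that is bounded above on this set
nonnegative on [G]. *)
Definition downward_epigraph (G : set H) : set (H * R) :=
  [set p | exists z v, [/\ C z, G v, (f z <= p.2%:E)%E & p.1 = z - v]].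

Lemma downward_epigraph_convex G : is_cone G ->
  forall p q t, downward_epigraph G p -> downward_epigraph G q ->
  0 <= t <= 1 -> downward_epigraph G (t *: p + (1 - t) *: q).
Proof.
move=> Gcone p q t [z [v [Cz Gv fz pzv]]] [z' [v' [Cz' Gv' fz' qzv']]] t01.
have /andP[t0 t1] := t01.
have t1' : 0 <= 1 - t by rewrite subr_ge0.
exists (t *: z + (1 - t) *: z'), (t *: v + (1 - t) *: v'); split.
- exact: C_cone.2.
- exact: Gcone.2.
- exact: epi_convex.
- by rewrite /= pzv qzv' !scalerBr opprD addrACA.
Qed.

(** Monotonicity can be used only inside [C].  The points that approximate [x]
may be outside [C], but after they are moved towards [e] they are near a
relative interior point of [G], and they stay in the closed span of [G]. *)
Lemma not_closure_downward_epigraph G e x r : is_face C G ->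
  C e -> (f e < +oo)%E -> G e -> G x ->
  (forall z, C z -> (f z < +oo)%E -> G z) ->
  (forall t, 0 < t < 1 -> exists2 eps : R, 0 < eps &
     forall v, closed_span G v -> `|t *: e + (1 - t) *: x - v| < eps -> G v) ->
  (r%:E < f x)%E -> ~ closure (downward_epigraph G) (x, r).
Proof.
move=> [GC Gcone Gdown] Ce fe Ge Gx domG Gint rfx xr.
have Cx : C x := GC _ Gx.
have [a fea] := lty_EFin_ub fe.
have xt t : 0 < t < 1 ->
  (f (t *: e + (1 - t) *: x)%R <= (t * a + (1 - t) * r)%:E)%E.
  move=> t01; have /andP[t0 t1] := t01; rewrite leNgt; apply/negP => lt_xt.
  have [eps eps0 ballG] := Gint t t01.
  have t1' : 0 <= 1 - t by rewrite subr_ge0 ltW.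
  have Cxt : C (t *: e + (1 - t) *: x) by apply: C_cone.2 => //; exact: ltW.
  have [b b1 b2] : exists2 b, t * a + (1 - t) * r < b &
      (b%:E < f (t *: e + (1 - t) *: x)%R)%E.
    exact: EFin_lt_dense.
  have near_f := (lsc_onP.1 f_lsc) _ _ Cxt b2.
  have c1 : t *: e + (1 - t) *: p.1 @[p --> (x, r)] --> t *: e + (1 - t) *: x.
    by apply: cvgD; [exact: cvg_cst|apply: cvgZr; exact: cvg_fst].
  have c2 : t * a + (1 - t) * p.2 @[p --> (x, r)] --> t * a + (1 - t) * r.
    by apply: cvgD; [exact: cvg_cst|apply: cvgMr; exact: cvg_snd].
  have [p [[z [v [Cz Gv fz pzv]]] [[fp bp] ballp]]] :
      downward_epigraph G `&`
      [set p | ((C (t *: e + (1 - t) *: p.1) ->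
                 (b%:E < f (t *: e + (1 - t) *: p.1)%R)%E) /\
                t * a + (1 - t) * p.2 < b) /\
               `|t *: e + (1 - t) *: x - (t *: e + (1 - t) *: p.1)| < eps] !=set0.
    apply: xr; apply: filterI; first apply: filterI.
    + exact: c1 near_f.
    + exact: cvgr_lt c2 _ b1.
    + exact: cvgr_dist_lt c1 _ eps0.
  have Gz : G z by apply: domG => //; exact: le_lt_trans fz (ltry _).
  set w := t *: e + (1 - t) *: p.1 in fp ballp.
  (* [w] is comparable with [t *: e + (1 - t) *: z]: their difference is
     [(1 - t) *: v]. *)
  have Gw : G w.
    apply: ballG ballp; rewrite /w pzv; apply: closed_spanD.
      by apply: closed_spanZ; exact: sub_closed_span.
    by apply: closed_spanZ; apply: closed_spanB; exact: sub_closed_span.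
  have := fp (GC _ Gw); apply/negP; rewrite -leNgt.
  apply: le_trans (_ : (t * a + (1 - t) * p.2)%:E <= _)%E; last first.
    by rewrite lee_fin ltW.
  apply: le_trans (epi_convex Ce Cz _ fea fz); last by rewrite (ltW t0) ltW.
  apply: f_mono; rewrite /cone_le ?subr0; last exact: GC.
  rewrite /w pzv scalerBr addrA subKr.
  by apply: coneZ => //; exact: GC.
(* Semicontinuity at [x] along the segment contradicts [xt] as [t] tends to
   0. *)
have [b b1 b2] : exists2 b, r < b & (b%:E < f x)%E.
  exact: EFin_lt_dense.
have near_f := (lsc_onP.1 f_lsc) _ _ Cx b2.
have c1 : t *: e + (1 - t) *: x @[t --> (0 : R)^'+] --> x.
  apply: cvg_at_right_filter.
  rewrite -[X in _ --> X](_ : 0 *: e + (1 - 0) *: x = x); last first.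
    by rewrite scale0r add0r subr0 scale1r.
  by apply: cvgD; apply: cvgZl => //; apply: cvgB => //; exact: cvg_cst.
have c2 : t * a + (1 - t) * r @[t --> (0 : R)^'+] --> r.
  apply: cvg_at_right_filter.
  rewrite -[X in _ --> X](_ : 0 * a + (1 - 0) * r = r); last by ring.
  by apply: cvgD; apply: cvgMl => //; apply: cvgB => //; exact: cvg_cst.
have [t [[[t0 t1] ft] bt]] : exists t, ((0 < t /\ t < 1) /\
    (C (t *: e + (1 - t) *: x) -> (b%:E < f (t *: e + (1 - t) *: x)%R)%E)) /\
    t * a + (1 - t) * r < b.
  apply: (@filter_ex _ ((0 : R)^'+)).
  apply: filterI; first apply: filterI; first apply: filterI.
  - exact: nbhs_right_gt.
  - exact: nbhs_right_lt.
  - exact: c1 near_f.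
  - exact: cvgr_lt c2 _ b1.
have t01 : 0 < t < 1 by rewrite t0.
have : (b%:E < b%:E)%E; last by rewrite ltxx.
apply: lt_trans (ft _) _.
  by apply: C_cone.2; rewrite ?subr_ge0 ?ltW.
by apply: le_lt_trans (xt t t01) _; rewrite lte_fin.
Qed.

End Functions.

(** * Separation and affine minorants *)

Lemma bounded_below_ge0 (R : realType) (a m : R) :
  (forall n, 0 <= n -> m <= n * a) -> 0 <= a.
Proof.
move=> ma; rewrite leNgt; apply/negP => a0.
have n0 : 0 <= (`|m| + 1) / - a by rewrite divr_ge0 ?addr_ge0 // oppr_ge0 ltW.
have := ma _ n0; rewrite invrN mulrN mulNr divfK ?lt_eqF // lerNr => m1.
by have := le_trans m1 (ler_norm (- m)); rewrite normrN gerDl ler10.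
Qed.

Section Separation.
Variables (R : realType) (H : completeNormedModType R).
Variables (dot : {dot H for (@idfun R)}) (hdot : norm_from_dot dot).
Variables (C : set H) (C_cone : is_cone C) (f : H -> \bar R).
Implicit Types (x y z : H) (G : set H) (r s c : R).

(** The normal [(y, s)] is the difference between [(x, r)] and its projection.
It has [y] in the dual cone of [G] and [s <= 0] because the downward epigraph
contains the rays from a point [(e, a)] in the directions [(- v, 0)], for [v] in
[G], and [(0, 1)]. *)
Lemma normal_of_downward_epigraph G e x r : is_face C G ->
  convex_on C f -> C e -> (f e < +oo)%E -> G x ->
  (forall z, C z -> (f z < +oo)%E -> G z) ->
  ~ closure (downward_epigraph C f G) (x, r) ->
  exists y s c, [/\ dual_cone dot G y, s <= 0, c < dot y x + s * r &
    forall z (b : R), C z -> (f z <= b%:E)%E -> dot y z + s * b <= c].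
Proof.
move=> [GC Gcone _] fconv Ce fe Gx domG xr.
have Ge : G e by exact: domG.
have [a fea] := lty_EFin_ub fe.
have E0 : downward_epigraph C f G (e, a).
  by exists e, 0; split => //=; [exact: Gcone.1|rewrite subr0].
have [p Ep hp] : exists2 p, closure (downward_epigraph C f G) p & forall q,
    downward_epigraph C f G q -> prod_dot dot ((x, r) - p) (q - p) <= 0.
  apply: (@variational_projection _ _ (prod_dot dot) 2) => //.
  - exact: prod_norm_le_dot.
  - exact: prod_dot_le_norm.
  - by exists (e, a).
  - by move=> p q t Ep Eq t01; exact: downward_epigraph_convex.
pose y := x - p.1; pose s := r - p.2; pose c := dot y p.1 + s * p.2.
have le_c z v (b : R) : C z -> G v -> (f z <= b%:E)%E ->
    dot y (z - v) + s * b <= c.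
  move=> Cz Gv fz.
  have /hp : downward_epigraph C f G (z - v, b) by exists z, v.
  by rewrite /prod_dot /= -/y -/s dotBr mulrBr /c; lra.
have Gp : closed_span G p.1.
  rewrite (closure_id (closed_span G)).1; last exact: closed_closed_span.
  move=> B pB.
  have [q [[z [v [Cz Gv fz qzv]]] Bq]] := Ep _ (cvg_fst pB).
  exists q.1; split => //; rewrite qzv.
  by apply: closed_spanB; apply: sub_closed_span => //;
    apply: domG => //; exact: le_lt_trans fz (ltry _).
exists y, s, c; split.
- split; first by apply: closed_spanB => //; exact: sub_closed_span.
  move=> v Gv; apply: (@bounded_below_ge0 _ _ (dot y e + s * a - c)) => n n0.
  have Gnv : G (n *: v) by exact: (coneZ Gcone).
  by have := le_c _ _ _ Ce Gnv fea; rewrite dotBr dotZr; lra.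
- rewrite -oppr_ge0.
  apply: (@bounded_below_ge0 _ _ (dot y e + s * a - c)) => n n0.
  have fen : (f e <= (a + n)%:E)%E.
    by apply: le_trans fea _; rewrite lee_fin lerDl.
  by have := le_c _ _ _ Ce Gcone.1 fen; rewrite subr0; lra.
- rewrite -subr_gt0.
  have -> : dot y x + s * r - c = prod_dot dot ((x, r) - p) ((x, r) - p).
    have yy : dot y y = dot y x - dot y p.1 by rewrite -dotBr.
    have ss : s * s = s * r - s * p.2 by rewrite -mulrBr.
    by rewrite /prod_dot /= -/y -/s yy ss /c; ring.
  apply: neq0_dnorm_gt0; rewrite subr_eq0; apply/eqP => xp.
  by apply: xr; rewrite xp.
- move=> z b Cz fz; have := le_c _ _ _ Cz Gcone.1 fz.
  by rewrite subr0.
Qed.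

Hypothesis hi : forall F : set H, is_face C F ->
  closed F /\ rel_interior F !=set0.
Hypothesis hii : forall F : set H, is_face C F ->
  dual_cone dot F `<=`
    [set orth_proj dot (closed_span F) x | x in dual_cone dot C].
Hypothesis f_Gamma : Gamma_mono C f.

Let f_gt_ninfty : gt_ninfty_on C f. Proof. by case: f_Gamma. Qed.

Lemma domain_dominating_point : exists e, [/\ C e, (f e < +oo)%E &
  forall z, C z -> (f z < +oo)%E -> exists2 l : R, 0 <= l & C (l *: e - z)].
Proof.
have [_ f_proper f_convex _ _] := f_Gamma.
pose D := [set z | C z /\ (f z < +oo)%E].
have D0 : D !=set0.
  apply: contrapT => nD; apply: f_proper => x Cx.
  apply/eqP; rewrite -leye_eq leNgt; apply/negP => fx.
  by apply: nD; exists x.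
have DC : D `<=` C by move=> z [].
have Dface : is_face C (face_gen C D).
  apply: face_genP => // x y t [Cx fx] [Cy fy] t01.
  have /andP[t0 t1] := t01.
  split; first by apply: C_cone.2; rewrite ?subr_ge0.
  apply: le_lt_trans (f_convex _ _ _ Cx Cy t01) _.
  case: (f x) fx (f_gt_ninfty Cx) => [a| |] // _ _.
  case: (f y) fy (f_gt_ninfty Cy) => [b| |] // _ _.
  exact: ltry.
have [e [Ce fe] edom] := dominating_point C_cone D0 DC (hi Dface).2.
by exists e; split => // z Cz fz; apply: edom.
Qed.

(** The face [G] generated by [e + x] contains [x] and the domain of [f], so the
normal provided by [G] can be replaced by any element of the dual cone of [C]
whose projection on the closed span of [G] is that normal. *)
Lemma separating_functional x r : C x -> (r%:E < f x)%E ->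
  exists y s c, [/\ dual_cone dot C y, s <= 0, c < dot y x + s * r &
    forall z (b : R), C z -> (f z <= b%:E)%E -> dot y z + s * b <= c].
Proof.
have [_ f_proper f_convex f_lsc f_mono] := f_Gamma.
have [e [Ce fe edom]] := domain_dominating_point => Cx rfx.
have Cex : C (e + x) by exact: coneD.
pose G := face_gen C [set e + x].
have Gface : is_face C G by exact: face_gen1P.
have domG z : C z -> (f z < +oo)%E -> G z.
  move=> Cz fz; have [l l0 lz] := edom z Cz fz.
  split => //; exists (e + x), l; split => //.
  by rewrite scalerDr addrAC; apply: coneD => //; exact: coneZ.
have Gx : G x.
  split => //; exists (e + x), 1; split => //.
  by rewrite scale1r addrK.
have xr : ~ closure (downward_epigraph C f G) (x, r).
  apply: (not_closure_downward_epigraph C_cone f_convex f_lsc f_mono Gface Ce)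
    => //.
    exact: domG.
  by move=> t t01; apply: segment_rel_interior => //; exact: (hi Gface).2.
have [y [s [c [Gy s0 cxr le_c]]]] :=
  normal_of_downward_epigraph Gface f_convex Ce fe Gx domG xr.
have [y' Cy' y'y] := hii Gface Gy.
have dotE z : G z -> dot y z = dot y' z.
  by move=> Gz; rewrite -y'y; apply: orth_projE => //; exact: sub_closed_span.
exists y', s, c; split => //; first by rewrite -dotE.
move=> z b Cz fz; rewrite -dotE ?le_c //.
by apply: domG => //; exact: le_lt_trans fz (ltry _).
Qed.

Definition affine_minorant y c :=
  dual_cone dot C y /\ forall z, C z -> ((dot y z - c)%:E <= f z)%E.

Lemma nonvertical_minorant y s c : dual_cone dot C y -> s < 0 ->
  (forall z (b : R), C z -> (f z <= b%:E)%E -> dot y z + s * b <= c) ->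
  affine_minorant ((- s)^-1 *: y) ((- s)^-1 * c).
Proof.
move=> Cy s0 le_c; have k0 : 0 < (- s)^-1 by rewrite invr_gt0 oppr_gt0.
split; first by apply: dual_coneZ => //; exact: ltW.
move=> z Cz; case: (f z) (le_c z) (f_gt_ninfty Cz) => [b| |] //; last first.
  by rewrite leey.
move=> /(_ b Cz (lexx _)) le_b _; rewrite lee_fin dotZl -mulrBr.
rewrite mulrC ler_pdivrMr ?oppr_gt0 //; lra.
Qed.

(** If the hyperplane that separates [(x, r)] is vertical, it is tilted: a
nonvertical minorant [y1 - d1] is increased by a multiple of [y - c], which is
nonpositive on the domain of [f] and positive at [x]. *)
Lemma affine_minorant_above x r : C x -> (r%:E < f x)%E ->
  exists y c, affine_minorant y c /\ r <= dot y x - c.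
Proof.
move=> Cx rfx.
have [y [s [c [Cy s0 cxr le_c]]]] := separating_functional Cx rfx.
have [s_lt0|] := ltP s 0.
  exists ((- s)^-1 *: y), ((- s)^-1 * c); split.
    exact: nonvertical_minorant le_c.
  rewrite dotZl -mulrBr mulrC ler_pdivlMr ?oppr_gt0 //; lra.
move=> s_ge0; have {s_ge0} s_eq0 : s = 0 by lra.
have [e [Ce fe _]] := domain_dominating_point.
have [a fea] : exists a, f e = a%:E.
  by case: (f e) fe (f_gt_ninfty Ce) => [a| |] // _ _; exists a.
have ae : ((a - 1)%:E < f e)%E by rewrite fea lte_fin; lra.
have [y0 [s1 [c1 [Cy0 _ cxr0 le_c0]]]] := separating_functional Ce ae.
(* At a point of the domain the separating hyperplane is not vertical. *)
have s1_lt0 : s1 < 0.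
  have := le_c0 e a Ce; rewrite fea lexx => /(_ isT); lra.
have [Cy1 min1] := nonvertical_minorant Cy0 s1_lt0 le_c0.
move: (_ *: y0) (_ * c1) Cy1 min1 => y1 d1 Cy1 min1.
rewrite s_eq0 mul0r addr0 in cxr.
pose n := `|r - (dot y1 x - d1)| / (dot y x - c).
have n0 : 0 <= n by rewrite divr_ge0 // subr_ge0 ltW.
have nE : n * (dot y x - c) = `|r - (dot y1 x - d1)|.
  by rewrite divfK // gt_eqF // subr_gt0.
exists (y1 + n *: y), (d1 + n * c); split; first split.
- by apply: dual_coneD => //; exact: dual_coneZ.
- move=> z Cz; case E : (f z) (f_gt_ninfty Cz) => [b| |] // _;
    last by rewrite leey.
  have := min1 z Cz; rewrite E !lee_fin dotDl dotZl => min1z.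
  have := le_c z b Cz; rewrite E lexx s_eq0 mul0r addr0 => /(_ isT) yz.
  have := ler_wpM2l n0 yz; lra.
- have := ler_norm (r - (dot y1 x - d1)); rewrite -nE dotDl dotZl; lra.
Qed.

End Separation.

(** * The monotone biconjugate *)

Section Biconjugate.
Variables (R : realType) (H : completeNormedModType R).
Variables (dot : {dot H for (@idfun R)}) (hdot : norm_from_dot dot).
Variables (C : set H) (f : H -> \bar R).
Hypothesis f_gt_ninfty : gt_ninfty_on C f.
Implicit Types (x y z : H) (a c r t : R).

Lemma mono_conjugate_ge z y (b : R) : C z -> f z = b%:E ->
  ((dot z y - b)%:E <= mono_conjugate dot C f y)%E.
Proof. by move=> Cz fz; apply: ereal_sup_ubound; exists z; rewrite ?fz. Qed.

Lemma mono_biconjugate_le x : C x -> (mono_biconjugate dot C f x <= f x)%E.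
Proof.
move=> Cx; apply: ge_ereal_sup => _ [y Cy <-].
case fx : (f x) (f_gt_ninfty Cx) => [b| |] // _; last by rewrite leey.
have := mono_conjugate_ge y Cx fx.
case: (mono_conjugate dot C f y) => [c| _|] //; last by rewrite addeNy leNye.
by rewrite -EFinB !lee_fin (dotC _ x y); lra.
Qed.

Lemma affine_minorant_le_biconjugate x y c : affine_minorant dot C f y c ->
  ((dot y x - c)%:E <= mono_biconjugate dot C f x)%E.
Proof.
move=> [Cy yf].
have fc : (mono_conjugate dot C f y <= c%:E)%E.
  apply: ge_ereal_sup => _ [z Cz <-].
  case fz : (f z) (f_gt_ninfty Cz) (yf z Cz) => [b| |] // _;
    last by rewrite addeNy leNye.
  by rewrite -EFinB !lee_fin (dotC _ z y); lra.
apply: (@le_trans _ _ ((dot y x)%:E - mono_conjugate dot C f y)%E); last first.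
  by apply: ereal_sup_ubound; exists y.
by rewrite EFinB leeB.
Qed.

Hypothesis f_proper : proper_on C f.

Lemma mono_conjugate_gt_ninfty y : (-oo < mono_conjugate dot C f y)%E.
Proof.
have [z [Cz fz]] : exists z, C z /\ f z <> +oo%E.
  apply: contrapT => nz; apply: f_proper => z Cz.
  by apply: contrapT => fz; apply: nz; exists z.
case E : (f z) fz (f_gt_ninfty Cz) => [b| |] // _ _.
by apply: lt_le_trans (mono_conjugate_ge y Cz E); exact: ltNyr.
Qed.

Lemma mono_biconjugate_gtP x a : (a%:E < mono_biconjugate dot C f x)%E ->
  exists y c, [/\ dual_cone dot C y, mono_conjugate dot C f y = c%:E &
                  a < dot y x - c].
Proof.
move=> /ereal_sup_gt[_ [y Cy <-]].
case E : (mono_conjugate dot C f y) (mono_conjugate_gt_ninfty y) => [c| |] // _.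
by rewrite -EFinB lte_fin => ac; exists y, c.
Qed.

Lemma mono_biconjugate_ge x y c : dual_cone dot C y ->
  mono_conjugate dot C f y = c%:E ->
  ((dot y x - c)%:E <= mono_biconjugate dot C f x)%E.
Proof.
by move=> Cy yc; apply: ereal_sup_ubound; exists y => //; rewrite yc.
Qed.

Lemma mono_biconjugate_convex : convex_on C (mono_biconjugate dot C f).
Proof.
move=> x y t Cx Cy /andP[t0 t1]; apply: ge_ereal_sup => _ [w Cw <-].
case E : (mono_conjugate dot C f w) (mono_conjugate_gt_ninfty w) => [c| |] // _;
  last by rewrite leNye.
have -> : ((dot w (t *: x + (1 - t) *: y)%R)%:E - c%:E =
    t%:E * (dot w x - c)%:E + (1 - t)%:E * (dot w y - c)%:E)%E.
  by rewrite -EFinB -!EFinM -EFinD dotDr !dotZr; congr (_%:E); ring.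
apply: leeD; apply: lee_wpmul2l; rewrite ?lee_fin ?subr_ge0 //;
  exact: mono_biconjugate_ge.
Qed.

Lemma mono_biconjugate_lsc : lsc_on C (mono_biconjugate dot C f).
Proof.
apply/lsc_onP => x a Cx /mono_biconjugate_gtP[y [c [Cy yc ax]]].
have cy : dot y z @[z --> x] --> dot y x.
  apply: (@dot_continuous _ _ dot 1) => // z; rewrite dotxx_norm ?mul1r //.
have ax' : a + c < dot y x by lra.
near=> z => Cz; apply: lt_le_trans (mono_biconjugate_ge z Cy yc).
rewrite lte_fin ltrBrDr; near: z; exact: cvgr_gt cy _ ax'.
Unshelve. all: by end_near. Qed.

Lemma mono_biconjugate_nondecreasing :
  cone_nondecreasing C (mono_biconjugate dot C f).
Proof.
move=> x y Cxy Cy; apply: ge_ereal_sup => _ [w Cw <-].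
apply: (@le_trans _ _ ((dot w x)%:E - mono_conjugate dot C f w)%E); last first.
  by apply: ereal_sup_ubound; exists w.
apply: leeB => //; rewrite lee_fin -subr_ge0 -dotBr.
exact: Cw.2.
Qed.

End Biconjugate.

(** * The theorem *)

Theorem theorem2p2 (R : realType) (H : completeNormedModType R)
    (dot : {dot H for (@idfun R)}) (hdot : norm_from_dot dot)
    (C : set H) (C_cone : is_cone C) (C_closed : closed C)
    (C_pointed : pointed_cone C)
    (hi : forall F : set H, is_face C F ->
      closed F /\ rel_interior F !=set0)
    (hii : forall F : set H, is_face C F ->
      dual_cone dot F `<=`
        [set orth_proj dot (closed_span F) x | x in dual_cone dot C])
    (f : H -> \bar R) (f_gt_ninfty : gt_ninfty_on C f)
    (f_proper : proper_on C f) :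
  (forall x, C x -> f x = mono_biconjugate dot C f x) <-> Gamma_mono C f.
Proof.
split=> [fE|f_Gamma x Cx].
  split=> //.
  - move=> x y t Cx Cy t01; have /andP[t0 t1] := t01.
    rewrite !fE //; first exact: mono_biconjugate_convex.
    by apply: C_cone.2; rewrite ?subr_ge0.
  - apply/lsc_onP => x a Cx; rewrite fE // => ax.
    have flsc := mono_biconjugate_lsc hdot f_gt_ninfty f_proper.
    have := (lsc_onP _ _).1 flsc x a Cx ax.
    by apply: filterS => z az Cz; rewrite fE //; exact: az.
  - move=> x y Cxy Cy.
    have {}Cy' : C y by move: Cy; rewrite /cone_le subr0.
    have Cx : C x by rewrite -(subrK y x); exact: coneD.
    by rewrite !fE //; exact: mono_biconjugate_nondecreasing.
apply/eqP; rewrite eq_le mono_biconjugate_le // andbT leNgt.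
apply/negP => lt_fx.
have [r lt_r rfx] : exists2 r : R,
    (mono_biconjugate dot C f x < r%:E)%E & (r%:E < f x)%E.
  case E : (mono_biconjugate dot C f x) lt_fx => [a| |] //.
  - by move=> /EFin_lt_dense[b ab bf]; exists b; rewrite ?lte_fin.
  - by rewrite ltNge leey.
  - case: (f x) => [b _| _|] //; last by exists 0; rewrite ?ltNyr ?ltry.
    by exists (b - 1); rewrite ?ltNyr // lte_fin ltrBlDr ltrDl.
have [y [c [min_yc r_le]]] :=
  affine_minorant_above hdot C_cone hi hii f_Gamma Cx rfx.
have := affine_minorant_le_biconjugate f_gt_ninfty x min_yc.
by apply/negP; rewrite -ltNge (lt_le_trans lt_r) // lee_fin.
Qed.
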